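(* Let $(E,\langle\cdot,\cdot\rangle,\Theta)$ be a pre-Courant algebroid and let $\mathcal{I},\mathcal{J}:E\to E$ be two anti-commuting endomorphisms ($\mathcal{I}\mathcal{J}=-\mathcal{J}\mathcal{I}$) such that $C_{\Theta}(\mathcal{I},\mathcal{J})=0$ and $\mathcal{I}^2=\lambda\,\mathrm{id}_E$ for some $\lambda\in\mathbb{R}\setminus\{0\}$. Then $$\mathsf{T}_{\Theta}\mathcal{J}=0\iff\mathsf{T}_{\Theta_{\mathcal{I}}}\mathcal{J}=0 .$$
   Context: Let $E\to M$ be a real vector bundle over a smooth manifold with a fibrewise non-degenerate symmetric bilinear form $\langle\cdot,\cdot\rangle$. A pre-Courant structure $\Theta$ on $(E,\langle\cdot,\cdot\rangle)$ is a pair $(\rho,[\cdot,\cdot])$, where $\rho:E\to TM$ is a vector bundle morphism (anchor) and $[\cdot,\cdot]:\Gamma(E)\times\Gamma(E)\to\Gamma(E)$ is an $\mathbb{R}$-bilinear (not necessarily skew-symmetric) bracket with $\rho(X)\cdot\langle Y,Z\rangle=\langle[X,Y],Z\rangle+\langle Y,[X,Z]\rangle$ and $\rho(X)\cdot\langle Y,Z\rangle=\langle X,[Y,Z]+[Z,Y]\rangle$ for all $X,Y,Z\in\Gamma(E)$; then $(E,\langle\cdot,\cdot\rangle,\Theta)$ is a pre-Courant algebroid. An endomorphism of $E$ is a vector bundle morphism $E\to E$ over $\mathrm{id}_M$. For an endomorphism $\mathcal{I}$, the deformed structure is $\Theta_{\mathcal{I}}=(\rho\circ\mathcal{I},[\cdot,\cdot]_{\mathcal{I}})$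 with $[X,Y]_{\mathcal{I}}=[\mathcal{I}X,Y]+[X,\mathcal{I}Y]-\mathcal{I}[X,Y]$. The deformation of $[\cdot,\cdot]_{\mathcal{I}}$ by an endomorphism $\mathcal{J}$ (same formula applied to the bracket $[\cdot,\cdot]_{\mathcal{I}}$) is denoted $[\cdot,\cdot]_{\mathcal{I},\mathcal{J}}$. The concomitant is $C_{\Theta}(\mathcal{I},\mathcal{J})(X,Y)=[X,Y]_{\mathcal{I},\mathcal{J}}+[X,Y]_{\mathcal{J},\mathcal{I}}$, $X,Y\in\Gamma(E)$. The Nijenhuis torsion of an endomorphism $\mathcal{J}$ with respect to $\Theta=(\rho,[\cdot,\cdot])$ is $\mathsf{T}_{\Theta}\mathcal{J}(X,Y)=[\mathcal{J}X,\mathcal{J}Y]-\mathcal{J}\big([X,Y]_{\mathcal{J}}\big)$. $\mathsf{T}_{\Theta_{\mathcal{I}}}\mathcal{J}$ is given by the same formula with the bracket $[\cdot,\cdot]$ replaced everywhere by $[\cdot,\cdot]_{\mathcal{I}}$. *)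

(* Defs.v *)
From HB Require Import structures.
From mathcomp Require Import all_boot all_order all_algebra.
From mathcomp Require Import all_classical all_reals all_analysis.

Set Implicit Arguments.
Unset Strict Implicit.
Unset Printing Implicit Defensive.

Import Order.TTheory GRing.Theory Num.Theory.
Import numFieldNormedType.Exports.

Local Open Scope classical_set_scope.
Local Open Scope ring_scope.

Section SmoothFunctions.
Context {R : realType}.

(* [Ck k U f] is meant for U open; for k > 0 all the directional derivatives
   of f are required to be of class C^(k-1), in particular continuous. *)
Fixpoint Ck (k n : nat) (U : set 'rV[R]_n) (f : 'rV[R]_n -> R) : Prop :=
  if k is k'.+1 then
    (forall x, U x -> differentiable f x) /\
    forall v : 'rV[R]_n, Ck k' U (fun x => 'D_v f x)
  else forall x, U x -> {for x, continuous f}.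

Definition smooth_fun n (U : set 'rV[R]_n) (f : 'rV[R]_n -> R) : Prop :=
  forall k, Ck k U f.

Definition smooth_map n m (U : set 'rV[R]_n) (g : 'rV[R]_n -> 'rV[R]_m) : Prop :=
  forall j, smooth_fun U (fun x => g x 0 j).

Lemma near_eq_differentiable (V W : normedModType R) (f g : V -> W) (x : V) :
  (\forall y \near x, f y = g y) -> differentiable f x -> differentiable g x.
Proof.
move=> fg df.
pose e y := g y - f y.
have -> : g = f + e by apply/funext => y; rewrite /e fctE addrC subrK.
apply: differentiableD => //.
have e0 : e x = 0 by rewrite /e (nbhs_singleton fg) subrr.
have E : e \o shift x = cst (e x) + (\0 : {linear V -> W}) +o_ 0 id.
  apply/eqaddoP => _/posnumP[eps].
  have : \forall h \near (0 : V), e (h + x) = 0.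
    move: fg; rewrite (near_shift 0) /=.
    apply: filterS => h /=; rewrite subr0 => Eh.
    by rewrite /e -Eh subrr.
  apply: filterS => h /= eh.
  by rewrite !fctE /= eh e0 addr0 subr0 normr0 mulr_ge0.
have c0 : continuous (\0 : V -> W) by move=> y; exact: cst_continuous.
apply/diff_locallyP; rewrite (diff_unique (df := (\0 : {linear V -> W})) c0 E).
by split.
Qed.

Section CkTheory.
Context {n : nat}.
Implicit Types (U : set 'rV[R]_n) (f g : 'rV[R]_n -> R).

Lemma Ck_continuous k U f : Ck k U f -> forall x, U x -> {for x, continuous f}.
Proof.
case: k => [//|k] [df _] x Ux.
exact/differentiable_continuous/df.
Qed.

Lemma CkW k U f : Ck k.+1 U f -> Ck k U f.
Proof.
elim: k f => [|k IH] f; first by move=> /Ck_continuous.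
by move=> [df Df]; split => // v; apply/IH/Df.
Qed.

Lemma Ck_local k U f :
  (forall x, U x -> exists2 V : set 'rV[R]_n, V x & Ck k (U `&` V) f) -> Ck k U f.
Proof.
elim: k f => [|k IH] f H.
  by move=> x Ux; have [V Vx] := H x Ux; apply.
split=> [x Ux|v]; first by have [V Vx [df _]] := H x Ux; exact: df.
by apply: IH => x Ux; have [V Vx [_ Df]] := H x Ux; exists V; [|exact: Df].
Qed.

Lemma Ck_sub k U U' f : U `<=` U' -> Ck k U' f -> Ck k U f.
Proof.
move=> UU'; elim: k f => [|k IH] f /=; first by move=> cf x /UU' /cf.
by move=> [df Df]; split=> [x /UU'|v]; [exact: df|exact/IH/Df].
Qed.

Lemma Ck_ext k U f g : open U -> (forall x, U x -> f x = g x) ->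
  Ck k U f -> Ck k U g.
Proof.
move=> oU; elim: k f g => [|k IH] f g fg.
  move=> cf x Ux.
  have nfg : \forall y \near x, f y = g y.
    by apply: filterS (open_nbhs_nbhs (conj oU Ux)) => y /fg.
  rewrite /prop_for /continuous_at -(fg _ Ux).
  exact: cvg_trans (near_eq_cvg nfg) (cf x Ux).
have nfg x : U x -> \forall y \near x, f y = g y.
  by move=> Ux; apply: filterS (open_nbhs_nbhs (conj oU Ux)) => y /fg.
move=> [df Df]; split=> [x Ux|v].
  exact: near_eq_differentiable (nfg x Ux) (df x Ux).
apply: IH (Df v) => x Ux; exact/near_eq_derive/nfg.
Qed.

Lemma Ck_cst k U (c : R) : Ck k U (fun=> c).
Proof.
elim: k c => [|k IH] c; first by move=> x _; exact: cst_continuous.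
split=> [x _|v]; first exact: differentiable_cst.
have -> : (fun x => 'D_v (fun=> c) x) = fun=> 0 :> R.
  by apply/funext => x; rewrite (derive_cst c).
exact: IH.
Qed.

Lemma Ck_add k U f g : open U -> Ck k U f -> Ck k U g ->
  Ck k U (fun x => f x + g x).
Proof.
move=> oU; elim: k f g => [|k IH] f g.
  by move=> cf cg x Ux; exact: (continuousD (cf x Ux) (cg x Ux)).
move=> [df Df] [dg Dg]; split=> [x Ux|v].
  by apply: differentiableD; [exact: df|exact: dg].
apply: Ck_ext (IH _ _ (Df v) (Dg v)) => // x Ux /=.
by rewrite deriveD//; apply: diff_derivable; [exact: df|exact: dg].
Qed.

Lemma Ck_mul k U f g : open U -> Ck k U f -> Ck k U g ->
  Ck k U (fun x => f x * g x).
Proof.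
move=> oU; elim: k f g => [|k IH] f g.
  by move=> cf cg x Ux; exact: (continuousM (cf x Ux) (cg x Ux)).
move=> Cf Cg; have [df Df] := Cf; have [dg Dg] := Cg.
split=> [x Ux|v].
  by apply: differentiableM; [exact: df|exact: dg].
have H := Ck_add oU (IH _ _ (CkW Cf) (Dg v)) (IH _ _ (CkW Cg) (Df v)).
apply: Ck_ext H => // x Ux /=.
by rewrite deriveM//; apply: diff_derivable; [exact: df|exact: dg].
Qed.

Lemma Ck_sum k U m (F : 'I_m -> 'rV[R]_n -> R) : open U ->
  (forall i, Ck k U (F i)) -> Ck k U (fun x => \sum_(i < m) F i x).
Proof.
move=> oU H.
elim: m F H => [|m IH] F H.
  by rewrite [X in Ck k U X](_ : _ = fun=> 0);
    [exact: Ck_cst|apply/funext => x; rewrite big_ord0].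
rewrite [X in Ck k U X](_ : _ =
    fun x => \sum_(i < m) F (widen_ord (leqnSn m) i) x + F ord_max x).
  by apply: Ck_add => //; exact: IH.
by apply/funext => x; rewrite big_ord_recr.
Qed.

Lemma Ck_coord k U i : Ck k U (fun x => x 0 i).
Proof.
case: k => [|k].
  by move=> x _; exact: (differentiable_continuous (differentiable_coord x 0 i)).
split=> [x _|v]; first exact: (differentiable_coord x 0 i).
have -> : (fun x => 'D_v (fun y : 'rV[R]_n => y 0 i) x) = fun=> v 0 i.
  apply/funext => x.
  have := derive_mx (@derivable_id R ('rV[R]_n) x v) => /matrixP /(_ 0 i).
  by rewrite derive_id mxE => <-.
exact: Ck_cst.
Qed.

End CkTheory.

Lemma row_continuous (T : topologicalType) m (g : T -> 'rV[R]_m) x :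
  (forall j, {for x, continuous (fun y => g y 0 j)}) -> {for x, continuous g}.
Proof.
move=> cg; apply/cvgrPdist_le => /= e e0; near=> y.
rewrite /Num.Def.normr/= mx_normrE (bigmax_le _ (ltW e0))//= => -[i j] _.
rewrite !mxE/= ord1 {i}; move: j; near: y; apply: filter_forall => j.
exact: ((cvgrPdist_le _ _).1 (cg j)).
Unshelve. all: by end_near. Qed.

Lemma differentiable_row n m (g : 'rV[R]_n -> 'rV[R]_m) x :
  (forall j, differentiable (fun y => g y 0 j) x) -> differentiable g x.
Proof.
move=> dg.
rewrite (_ : g = \sum_(j < m) (fun y => g y 0 j *: delta_mx 0 j)).
  by apply: differentiable_sum => j; apply: differentiableZl; exact: dg.
by apply/funext => y; rewrite fct_sumE [LHS]row_sum_delta.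
Qed.

Lemma derive_row n m (g : 'rV[R]_n -> 'rV[R]_m) x v j :
  differentiable g x -> 'D_v g x 0 j = 'D_v (fun y => g y 0 j) x.
Proof.
by move=> dg; rewrite derive_mx ?mxE//; exact: diff_derivable.
Qed.

Lemma derive_chain (U V W : normedModType R) (g : U -> V) (f : V -> W) x v :
  differentiable g x -> differentiable f (g x) ->
  'D_v (f \o g) x = 'D_('D_v g x) f (g x).
Proof.
move=> dg df.
by rewrite (deriveE _ (differentiable_comp dg df)) (diff_comp dg df)
  (deriveE _ df) (deriveE _ dg).
Qed.

Lemma derive_basis n (f : 'rV[R]_n -> R) x v : differentiable f x ->
  'D_v f x = \sum_(i < n) v 0 i * 'D_(delta_mx 0 i) f x.
Proof.
move=> df; rewrite deriveE// {1}(row_sum_delta v) linear_sum/=.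
by apply: eq_bigr => i _; rewrite linearZ/= deriveE.
Qed.

Lemma Ck_comp k n m (U : set 'rV[R]_n) (W : set 'rV[R]_m)
    (g : 'rV[R]_n -> 'rV[R]_m) (f : 'rV[R]_m -> R) :
  open U -> (forall x, U x -> W (g x)) ->
  (forall j, Ck k U (fun x => g x 0 j)) -> Ck k W f -> Ck k U (f \o g).
Proof.
move=> oU UW; elim: k f => [|k IH] f Cg Cf.
  move=> x Ux; apply: continuous_comp; last exact/Cf/UW.
  by apply: row_continuous => j; exact: Cg.
have dg x : U x -> differentiable g x.
  by move=> Ux; apply: differentiable_row => j; have [d _] := Cg j; exact: d.
have [df Df] := Cf.
split=> [x Ux|v].
  by apply: differentiable_comp; [exact: dg|exact/df/UW].
have H : Ck k U (fun x => \sum_(i < m)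
    ('D_v (fun y => g y 0 i) x * 'D_(delta_mx 0 i) f (g x))).
  apply: Ck_sum => // i; apply: Ck_mul => //.
    by have [_ Dg] := Cg i; exact: Dg.
  by apply: (IH (fun y => 'D_(delta_mx 0 i) f y)); [move=> l; exact/CkW/Cg|exact: Df].
apply: Ck_ext H => // x Ux.
rewrite derive_chain; [|exact: dg|exact/df/UW].
rewrite derive_basis; last exact/df/UW.
by apply: eq_bigr => i _; rewrite derive_row//; exact: dg.
Qed.

End SmoothFunctions.

Record chart (R : realType) (n : nat) (M : topologicalType) := Chart {
  chart_dom : set M;
  chart_cod : set 'rV[R]_n;
  chart_fwd : M -> 'rV[R]_n;
  chart_bwd : 'rV[R]_n -> M;
  chart_dom_open : open chart_dom;
  chart_cod_open : open chart_cod;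
  chart_fwd_cod : forall x, chart_dom x -> chart_cod (chart_fwd x);
  chart_bwd_dom : forall y, chart_cod y -> chart_dom (chart_bwd y);
  chart_fwdK : forall x, chart_dom x -> chart_bwd (chart_fwd x) = x;
  chart_bwdK : forall y, chart_cod y -> chart_fwd (chart_bwd y) = y;
  chart_fwd_continuous : forall x, chart_dom x -> {for x, continuous chart_fwd};
  chart_bwd_continuous : forall y, chart_cod y -> {for y, continuous chart_bwd}
}.

(* An atlas need not be maximal: it determines the smooth structure. *)
Record smoothManifold (R : realType) (n : nat) := SmoothManifold {
  manifold_space :> topologicalType;
  manifold_hausdorff : hausdorff_space manifold_space;
  manifold_second_countable : @second_countable manifold_space;
  atlas : set (chart R n manifold_space);
  atlas_cover : forall x : manifold_space,
    exists2 c, atlas c & chart_dom c x;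
  atlas_compatible : forall c d, atlas c -> atlas d ->
    smooth_map (chart_cod c `&` chart_bwd c @^-1` chart_dom d)
      (chart_fwd d \o chart_bwd c)
}.

Arguments atlas {R n}.

Section SmoothOn.
Context {R : realType} {n : nat} {M : smoothManifold R n}.
Implicit Types (A B : set M) (f g : M -> R) (c d : chart R n M).

Definition smooth_on A f : Prop := forall c, atlas M c ->
  smooth_fun (chart_cod c `&` chart_bwd c @^-1` A) (f \o chart_bwd c).

Lemma chart_preimage_open c A : open A ->
  open (chart_cod c `&` chart_bwd c @^-1` A).
Proof.
move=> oA; rewrite openE => y [cy Ay]; apply: filterI.
  by apply: open_nbhs_nbhs; split => //; exact: chart_cod_open.
exact: (chart_bwd_continuous cy) (open_nbhs_nbhs (conj oA Ay)).
Qed.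

Lemma smooth_on_ext A f g : open A -> (forall x, A x -> f x = g x) ->
  smooth_on A f -> smooth_on A g.
Proof.
move=> oA fg Sf c Mc k.
by apply: Ck_ext (Sf c Mc k) => [|y [_ /fg]//]; exact: chart_preimage_open.
Qed.

Lemma smooth_on_sub A B f : A `<=` B -> smooth_on B f -> smooth_on A f.
Proof.
move=> AB Sf c Mc k; apply: Ck_sub (Sf c Mc k) => y [cy Ay].
by split => //; exact: AB.
Qed.

Lemma smooth_on_local A f :
  (forall x, A x -> exists2 B : set M, B x & smooth_on (A `&` B) f) ->
  smooth_on A f.
Proof.
move=> H c Mc k; apply: Ck_local => y [cy Ay].
have [B By SB] := H _ Ay; exists (chart_bwd c @^-1` B) => //.
by apply: Ck_sub (SB c Mc k) => z [[]].
Qed.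

Lemma smooth_on_cst A (a : R) : smooth_on A (fun=> a).
Proof. by move=> c _ k; exact: Ck_cst. Qed.

Lemma smooth_on_add A f g : open A -> smooth_on A f -> smooth_on A g ->
  smooth_on A (fun x => f x + g x).
Proof.
move=> oA Sf Sg c Mc k.
exact: Ck_add (chart_preimage_open oA) (Sf c Mc k) (Sg c Mc k).
Qed.

Lemma smooth_on_mul A f g : open A -> smooth_on A f -> smooth_on A g ->
  smooth_on A (fun x => f x * g x).
Proof.
move=> oA Sf Sg c Mc k.
exact: Ck_mul (chart_preimage_open oA) (Sf c Mc k) (Sg c Mc k).
Qed.

Lemma smooth_on_sum m A (F : 'I_m -> M -> R) : open A ->
  (forall i, smooth_on A (F i)) -> smooth_on A (fun x => \sum_(i < m) F i x).
Proof.
move=> oA SF c Mc k.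
by apply: (Ck_sum (F := fun i => F i \o chart_bwd c)
  (chart_preimage_open oA)) => i; exact: SF.
Qed.

Lemma smooth_on_chart c A (h : 'rV[R]_n -> R) : atlas M c -> open A ->
  A `<=` chart_dom c ->
  smooth_fun (chart_cod c `&` chart_bwd c @^-1` A) h ->
  smooth_on A (h \o chart_fwd c).
Proof.
move=> Mc oA Ac Sh d Md k.
apply: (Ck_comp (g := chart_fwd c \o chart_bwd d) (f := h)
  (chart_preimage_open oA) _ _ (Sh k)) => [y [dy Ay]|j].
  split; first exact/chart_fwd_cod/Ac.
  by rewrite /= chart_fwdK//; exact: Ac.
apply: Ck_sub (atlas_compatible Md Mc j k) => y [dy Ay].
by split => //; exact: Ac.
Qed.

End SmoothOn.

(* A trivialization is fibrewise linear and invertible over its domain; its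
   values off the domain are irrelevant. *)
Record trivialization (R : realType) (n r : nat) (M : smoothManifold R n)
    (E : M -> lmodType R) := Trivialization {
  triv_dom : set M;
  triv_fwd : forall x : M, E x -> 'rV[R]_r;
  triv_bwd : forall x : M, 'rV[R]_r -> E x;
  triv_dom_open : open triv_dom;
  triv_linear : forall x, triv_dom x -> linear (@triv_fwd x);
  triv_fwdK : forall x, triv_dom x -> cancel (@triv_fwd x) (triv_bwd x);
  triv_bwdK : forall x, triv_dom x -> cancel (triv_bwd x) (@triv_fwd x)
}.

(* The smooth structure of the total space is the one for which the given
   local trivializations are diffeomorphisms; it exists because the
   transition functions are smooth. *)
Record vectorBundle (R : realType) (n : nat) (M : smoothManifold R n)
    (r : nat) := VectorBundle {
  fibre :> M -> lmodType R;
  trivs : set (trivialization r fibre);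
  trivs_cover : forall x : M, exists2 t, trivs t & triv_dom t x;
  trivs_compatible : forall s t, trivs s -> trivs t -> forall u j,
    smooth_on (triv_dom s `&` triv_dom t)
      (fun x => triv_fwd t (triv_bwd s x u) 0 j)
}.

Arguments trivs {R n M r}.

Section VectorBundles.
Context {R : realType} {n : nat} {M : smoothManifold R n}.

Definition smooth_local_section r (E : vectorBundle M r) (A : set M)
    (X : forall x : M, E x) : Prop :=
  forall t, trivs E t -> forall j,
    smooth_on (A `&` triv_dom t) (fun x => triv_fwd t (X x) 0 j).

(* Smoothness of f amounts to smoothness of its matrix in local
   trivializations: f maps local frames to smooth local sections. *)
Record bundleMorphism r s (E : vectorBundle M r) (F : vectorBundle M s) :=
  BundleMorphism {
    morphism_map :> forall x : M, {linear E x -> F x};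
    morphism_smooth : forall t, trivs E t -> forall u,
      smooth_local_section (triv_dom t)
        (fun x => morphism_map x (triv_bwd t x u))
  }.

Lemma triv_bwd_linear r (E : vectorBundle M r) (t : trivialization r E) x :
  triv_dom t x -> linear (triv_bwd t x).
Proof.
move=> tx a u v; apply: (can_inj (triv_fwdK tx)).
by rewrite (triv_linear tx) !(triv_bwdK tx).
Qed.

Lemma morphism_local_section r s (E : vectorBundle M r) (F : vectorBundle M s)
    (f : bundleMorphism E F) (A : set M) (X : forall x, E x) : open A ->
  smooth_local_section A X -> smooth_local_section A (fun x => f x (X x)).
Proof.
move=> oA SX t Et j; apply: smooth_on_local => x [Ax tx].
have [p Ep px] := trivs_cover E x.
exists (triv_dom p) => //.
have oU : open (A `&` triv_dom t `&` triv_dom p).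
  by do 2?apply: openI => //; exact: triv_dom_open.
have H : smooth_on (A `&` triv_dom t `&` triv_dom p) (fun x =>
    \sum_(i < r) triv_fwd p (X x) 0 i *
      triv_fwd t (f x (triv_bwd p x (delta_mx 0 i))) 0 j).
  apply: smooth_on_sum => // i; apply: smooth_on_mul => //.
    by apply: smooth_on_sub (SX p Ep i) => y [[]].
  by apply: smooth_on_sub (morphism_smooth f Ep _ Et j) => y [[]].
apply: smooth_on_ext H => // y [[Ay ty] py].
pose bL := HB.pack_for {linear 'rV[R]_r -> E y} (triv_bwd p y)
  (GRing.isLinear.Build _ _ _ _ _ (triv_bwd_linear py)).
pose tL := HB.pack_for {linear F y -> 'rV[R]_s} (@triv_fwd _ _ _ _ _ t y)
  (GRing.isLinear.Build _ _ _ _ _ (triv_linear ty)).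
rewrite -[X y in RHS](triv_fwdK py) {2}[triv_fwd p (X y)]row_sum_delta.
rewrite -[triv_bwd p y _]/(bL _) !linear_sum -[triv_fwd t _]/(tL _).
rewrite linear_sum summxE; apply: eq_bigr => i _.
by rewrite !linearZ mxE.
Qed.

Lemma comp_morphism_smooth r s q (E : vectorBundle M r) (F : vectorBundle M s)
    (G : vectorBundle M q) (g : bundleMorphism F G) (f : bundleMorphism E F) t :
  trivs E t -> forall u, smooth_local_section (triv_dom t)
    (fun x => (g x \o f x) (triv_bwd t x u)).
Proof.
move=> Et u; apply: morphism_local_section; first exact: triv_dom_open.
exact: morphism_smooth.
Qed.

Definition comp_morphism r s q (E : vectorBundle M r) (F : vectorBundle M s)
    (G : vectorBundle M q) (g : bundleMorphism F G) (f : bundleMorphism E F) :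
  bundleMorphism E G := BundleMorphism
    (morphism_map := fun x => g x \o f x : {linear E x -> G x})
    (comp_morphism_smooth g f).

End VectorBundles.

Section Sections.
Context (R : realType) (n : nat) (M : smoothManifold R n) (r : nat).

Record smoothSection (E : vectorBundle M r) := SmoothSection {
  section_map :> forall x : M, E x;
  section_smooth : smooth_local_section setT section_map
}.

HB.instance Definition _ (E : vectorBundle M r) := gen_eqMixin (smoothSection E).
HB.instance Definition _ (E : vectorBundle M r) :=
  gen_choiceMixin (smoothSection E).

Variable E : vectorBundle M r.
Implicit Types X Y Z : smoothSection E.

Lemma smoothSectionP X Y : (forall x, X x = Y x) -> X = Y.
Proof.
case: X Y => [X SX] [Y SY] /= XY.
have {}XY : X = Y by exact: functional_extensionality_dep.
by rewrite XY in SX *; rewrite (Prop_irrelevance SX SY).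
Qed.

Let openT (t : trivialization r E) : open (setT `&` triv_dom t).
Proof. by rewrite setTI; exact: triv_dom_open. Qed.

Lemma section_lin_smooth (a : R) X Y :
  smooth_local_section setT (fun x => a *: X x + Y x).
Proof.
move=> t Et j.
apply: (smooth_on_ext (f := fun x => a * triv_fwd t (X x) 0 j +
  triv_fwd t (Y x) 0 j)) => //.
  by move=> x [_ tx]; rewrite (triv_linear tx) !mxE.
apply: smooth_on_add => //; last exact: section_smooth.
by apply: smooth_on_mul => //; [exact: smooth_on_cst|exact: section_smooth].
Qed.

Lemma section0_smooth : smooth_local_section setT (fun x => 0 : E x).
Proof.
move=> t Et j; apply: (smooth_on_ext (f := fun=> 0)) => //.
  move=> x [_ tx].
  pose tL := HB.pack_for {linear E x -> 'rV[R]_r} (@triv_fwd _ _ _ _ _ t x)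
    (GRing.isLinear.Build _ _ _ _ _ (triv_linear tx)).
  by rewrite -[triv_fwd t _]/(tL _) linear0 mxE.
exact: smooth_on_cst.
Qed.

Lemma section_add_smooth X Y : smooth_local_section setT (fun x => X x + Y x).
Proof.
rewrite (_ : (fun x => _) = fun x => 1 *: X x + Y x); last first.
  by apply: functional_extensionality_dep => x; rewrite scale1r.
exact: section_lin_smooth.
Qed.

Definition section0 := SmoothSection section0_smooth.
Definition section_add X Y := SmoothSection (section_add_smooth X Y).

Lemma section_scale_smooth (a : R) X :
  smooth_local_section setT (fun x => a *: X x).
Proof.
rewrite (_ : (fun x => _) = fun x => a *: X x + section0 x); last first.
  by apply: functional_extensionality_dep => x; rewrite addr0.
exact: section_lin_smooth.
Qed.

Definition section_scale (a : R) X := SmoothSection (section_scale_smooth a X).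

Lemma section_opp_smooth X : smooth_local_section setT (fun x => - X x).
Proof.
rewrite (_ : (fun x => _) = fun x => (-1) *: X x); last first.
  by apply: functional_extensionality_dep => x; rewrite scaleN1r.
exact: section_scale_smooth.
Qed.

Definition section_opp X := SmoothSection (section_opp_smooth X).

Fact section_addA : associative section_add.
Proof. by move=> X Y Z; apply: smoothSectionP => x; exact: addrA. Qed.
Fact section_addC : commutative section_add.
Proof. by move=> X Y; apply: smoothSectionP => x; exact: addrC. Qed.
Fact section_add0 : left_id section0 section_add.
Proof. by move=> X; apply: smoothSectionP => x; exact: add0r. Qed.
Fact section_addN : left_inverse section0 section_opp section_add.
Proof. by move=> X; apply: smoothSectionP => x; exact: addNr. Qed.

HB.instance Definition _ := GRing.isZmodule.Build (smoothSection E)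
  section_addA section_addC section_add0 section_addN.

Fact section_scaleA a b X :
  section_scale a (section_scale b X) = section_scale (a * b) X.
Proof. by apply: smoothSectionP => x; exact: scalerA. Qed.
Fact section_scale1 : left_id 1 section_scale.
Proof. by move=> X; apply: smoothSectionP => x; exact: scale1r. Qed.
Fact section_scaleDr : right_distributive section_scale +%R.
Proof. by move=> a X Y; apply: smoothSectionP => x; exact: scalerDr. Qed.
Fact section_scaleDl X : {morph section_scale^~ X : a b / a + b}.
Proof. by move=> a b; apply: smoothSectionP => x; exact: scalerDl. Qed.

HB.instance Definition _ := GRing.Zmodule_isLmodule.Build R (smoothSection E)
  section_scaleA section_scale1 section_scaleDr section_scaleDl.

End Sections.

Section SectionAction.
Context {R : realType} {n : nat} {M : smoothManifold R n} {r s : nat}.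
Context {E : vectorBundle M r} {F : vectorBundle M s}.

Lemma on_section_smooth (f : bundleMorphism E F) (X : smoothSection E) :
  smooth_local_section setT (fun x => f x (X x)).
Proof.
apply: morphism_local_section; [exact: openT|exact: section_smooth].
Qed.

Definition on_section (f : bundleMorphism E F) (X : smoothSection E) :
  smoothSection F := SmoothSection (on_section_smooth f X).

End SectionAction.

Section TangentBundle.
Context {R : realType} {n : nat} (M : smoothManifold R n).
Implicit Types (c d : chart R n M) (x : M).

Definition chart_at x : chart R n M := s2val (cid2 (atlas_cover x)).

Lemma chart_at_atlas x : atlas M (chart_at x).
Proof. by rewrite /chart_at; case: cid2. Qed.

Lemma chart_at_dom x : chart_dom (chart_at x) x.
Proof. by rewrite /chart_at; case: cid2. Qed.

(* Jacobian at x of the change of coordinates from c to d, applied to v. *)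
Definition coord_change c d x (v : 'rV[R]_n) : 'rV[R]_n :=
  'D_v (chart_fwd d \o chart_bwd c) (chart_fwd c x).

Lemma transition_differentiable c d x : atlas M c -> atlas M d ->
  chart_dom c x -> chart_dom d x ->
  differentiable (chart_fwd d \o chart_bwd c) (chart_fwd c x).
Proof.
move=> Mc Md cx dx; apply: differentiable_row => j.
have cdx : (chart_cod c `&` chart_bwd c @^-1` chart_dom d) (chart_fwd c x).
  by split; [exact: chart_fwd_cod|rewrite /preimage /= chart_fwdK].
by have [H _] := atlas_compatible Mc Md j 1; exact: H.
Qed.

Lemma coord_change_linear c d x : atlas M c -> atlas M d ->
  chart_dom c x -> chart_dom d x -> linear (coord_change c d x).
Proof.
move=> Mc Md cx dx a u v; rewrite /coord_change !deriveE ?linearP//;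
  exact: transition_differentiable.
Qed.

Lemma coord_change_comp c d e x v :
  atlas M c -> atlas M d -> atlas M e ->
  chart_dom c x -> chart_dom d x -> chart_dom e x ->
  coord_change d e x (coord_change c d x v) = coord_change c e x v.
Proof.
move=> Mc Md Me cx dx ex; rewrite /coord_change.
have E : (chart_fwd d \o chart_bwd c) (chart_fwd c x) = chart_fwd d x.
  by rewrite /= chart_fwdK.
rewrite -{1}E -derive_chain ?E; [|exact: transition_differentiable..].
apply: near_eq_derive.
have oU := chart_preimage_open (c := c) (chart_dom_open d).
have cdx : (chart_cod c `&` chart_bwd c @^-1` chart_dom d) (chart_fwd c x).
  by split; [exact: chart_fwd_cod|rewrite /preimage /= chart_fwdK].
by apply: filterS (open_nbhs_nbhs (conj oU cdx)) => y [_ dy]/=;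
  rewrite chart_fwdK.
Qed.

Lemma coord_change_id c x v : atlas M c -> chart_dom c x ->
  coord_change c c x v = v.
Proof.
move=> Mc cx; rewrite -[RHS](derive_id (chart_fwd c x) v).
apply: near_eq_derive.
have oc := chart_cod_open (c := c).
by apply: filterS (open_nbhs_nbhs (conj oc (chart_fwd_cod cx))) => y cy /=;
  rewrite chart_bwdK.
Qed.

(* A tangent vector at x is represented by its components in chart_at x. *)
Definition tangent_space x : lmodType R := 'rV[R]_n.

Section TangentTriv.
Variables (c : chart R n M) (Mc : atlas M c).

Fact tangent_triv_linear x : chart_dom c x ->
  linear (coord_change (chart_at x) c x : tangent_space x -> 'rV[R]_n).
Proof.
move=> cx; exact: (coord_change_linear (chart_at_atlas x) Mc (chart_at_dom x)).
Qed.

Fact tangent_triv_fwdK x : chart_dom c x ->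
  cancel (coord_change (chart_at x) c x : tangent_space x -> 'rV[R]_n)
    (coord_change c (chart_at x) x).
Proof.
move=> cx v; rewrite coord_change_comp ?coord_change_id//;
  by [exact: chart_at_atlas|exact: chart_at_dom].
Qed.

Fact tangent_triv_bwdK x : chart_dom c x ->
  cancel (coord_change c (chart_at x) x)
    (coord_change (chart_at x) c x : tangent_space x -> 'rV[R]_n).
Proof.
move=> cx v; rewrite coord_change_comp ?coord_change_id//;
  by [exact: chart_at_atlas|exact: chart_at_dom].
Qed.

Definition tangent_triv : trivialization n tangent_space :=
  Trivialization (chart_dom_open c) tangent_triv_linear
    tangent_triv_fwdK tangent_triv_bwdK.

End TangentTriv.

Definition tangent_trivs : set (trivialization n tangent_space) :=
  [set t | exists c (Mc : atlas M c), t = tangent_triv Mc].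

Fact tangent_trivs_cover x : exists2 t, tangent_trivs t & triv_dom t x.
Proof.
exists (tangent_triv (chart_at_atlas x)); last exact: chart_at_dom.
by exists (chart_at x), (chart_at_atlas x).
Qed.

Fact tangent_trivs_compatible s t : tangent_trivs s -> tangent_trivs t ->
  forall u j, smooth_on (triv_dom s `&` triv_dom t)
    (fun x => triv_fwd t (triv_bwd s x u) 0 j).
Proof.
move=> [c [Mc ->]] [d [Md ->]] u j /=.
have oU : open (chart_dom c `&` chart_dom d).
  by apply: openI; exact: chart_dom_open.
have H : smooth_on (chart_dom c `&` chart_dom d)
  ((fun y => 'D_u (fun z => (chart_fwd d \o chart_bwd c) z 0 j) y)
    \o chart_fwd c).
  apply: (smooth_on_chart Mc) => // k.
  have [_ H] := atlas_compatible Mc Md j k.+1.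
  by apply: Ck_sub (H u) => y [cy [_ dy]].
apply: smooth_on_ext H => // x [cx dx] /=.
rewrite coord_change_comp//; [|exact: chart_at_atlas|exact: chart_at_dom].
by rewrite /coord_change derive_row//; exact: transition_differentiable.
Qed.

Definition tangentBundle : vectorBundle M n :=
  VectorBundle tangent_trivs_cover tangent_trivs_compatible.

Definition tangent_derive x (v : tangentBundle x) (f : M -> R) : R :=
  'D_(v : 'rV[R]_n) (f \o chart_bwd (chart_at x)) (chart_fwd (chart_at x) x).

(* The definition of tangent_derive does not depend on the choice of chart_at. *)
Lemma tangent_deriveE c x (v : tangentBundle x) (A : set M) (f : M -> R) :
  atlas M c -> chart_dom c x -> A x -> smooth_on A f ->
  tangent_derive v f =
  'D_(coord_change (chart_at x) c x v) (f \o chart_bwd c) (chart_fwd c x).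
Proof.
move=> Mc cx Ax Sf; set e := chart_at x.
have Me : atlas M e by exact: chart_at_atlas.
have ex : chart_dom e x by exact: chart_at_dom.
have E : (chart_fwd c \o chart_bwd e) (chart_fwd e x) = chart_fwd c x.
  by rewrite /= chart_fwdK.
have df : differentiable (f \o chart_bwd c) (chart_fwd c x).
  have cA : (chart_cod c `&` chart_bwd c @^-1` A) (chart_fwd c x).
    by split; [exact: chart_fwd_cod|rewrite /preimage /= chart_fwdK].
  by have [H _] := Sf c Mc 1%N; exact: H.
rewrite /coord_change -{1}E -derive_chain ?E//;
  last exact: transition_differentiable.
apply: near_eq_derive.
have oU := chart_preimage_open (c := e) (chart_dom_open c).
have ecx : (chart_cod e `&` chart_bwd e @^-1` chart_dom c) (chart_fwd e x).
  by split; [exact: chart_fwd_cod|rewrite /preimage /= chart_fwdK].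
by apply: filterS (open_nbhs_nbhs (conj oU ecx)) => y [_ dy]/=;
  rewrite chart_fwdK.
Qed.

End TangentBundle.

Section PreCourant.
Context {R : realType} {n : nat} {M : smoothManifold R n} {r : nat}.

Record bundleMetric (E : vectorBundle M r) := BundleMetric {
  metric_form :> forall x : M, E x -> E x -> R;
  metric_linear : forall x (u : E x), scalar (metric_form u);
  metric_sym : forall x (u v : E x), metric_form u v = metric_form v u;
  metric_nondegenerate : forall x (u : E x),
    (forall v, metric_form u v = 0) -> u = 0;
  metric_smooth : forall t, trivs E t -> forall u v,
    smooth_on (triv_dom t)
      (fun x => metric_form (triv_bwd t x u) (triv_bwd t x v))
}.

(* The pair (rho, [.,.]) without any axiom: the deformation of a pre-Courant
   structure by an endomorphism is only such a pair in general. *)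
Record anchoredBracket (E : vectorBundle M r) := AnchoredBracket {
  anchor : bundleMorphism E (tangentBundle M);
  bracket : smoothSection E -> smoothSection E -> smoothSection E
}.

Definition anchor_derive (E : vectorBundle M r) (Theta : anchoredBracket E)
    (X : smoothSection E) (f : M -> R) (x : M) : R :=
  tangent_derive (anchor Theta x (X x)) f.

Record pre_courant (E : vectorBundle M r) (g : bundleMetric E)
    (Theta : anchoredBracket E) : Prop := PreCourant {
  bracket_linearl : forall Y, linear (fun X => bracket Theta X Y);
  bracket_linearr : forall X, linear (bracket Theta X);
  bracket_metric : forall (X Y Z : smoothSection E) (x : M),
    anchor_derive Theta X (fun y => g y (Y y) (Z y)) x =
    g x (bracket Theta X Y x) (Z x) + g x (Y x) (bracket Theta X Z x);
  bracket_sym : forall (X Y Z : smoothSection E) (x : M),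
    anchor_derive Theta X (fun y => g y (Y y) (Z y)) x =
    g x (X x) ((bracket Theta Y Z + bracket Theta Z Y) x)
}.

Definition deform (E : vectorBundle M r) (I : bundleMorphism E E)
    (Theta : anchoredBracket E) : anchoredBracket E :=
  AnchoredBracket (comp_morphism (anchor Theta) I)
    (fun X Y => bracket Theta (on_section I X) Y +
                bracket Theta X (on_section I Y) -
                on_section I (bracket Theta X Y)).

Definition concomitant (E : vectorBundle M r) (Theta : anchoredBracket E)
    (I J : bundleMorphism E E) (X Y : smoothSection E) : smoothSection E :=
  bracket (deform J (deform I Theta)) X Y +
  bracket (deform I (deform J Theta)) X Y.

Definition torsion (E : vectorBundle M r) (Theta : anchoredBracket E)
    (J : bundleMorphism E E) (X Y : smoothSection E) : smoothSection E :=
  bracket Theta (on_section J X) (on_section J Y) -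
  on_section J (bracket (deform J Theta) X Y).

End PreCourant.

(* Main.v *)
(* Let T be the torsion of J with respect to the original bracket.  Since I and J
   anticommute, the concomitant is twice
     [JX,IY] + [IX,JY] - I([JX,Y] + [X,JY]) - J([IX,Y] + [X,IY]),
   and applying J to the vanishing of this expression turns the torsion of J with
   respect to [.,.]_I into -(T(IX,Y) + T(X,IY) + I T(X,Y)).  If the latter
   vanishes, evaluating it at (IX,Y) and (X,IY) gives
   2 T(IX,IY) = - lambda T(X,Y); using this twice,
   4 lambda^2 T(X,Y) = lambda^2 T(X,Y), whence T = 0. *)
Require Import Defs.
From HB Require Import structures.
From mathcomp Require Import all_boot all_order all_algebra.
From mathcomp Require Import all_classical all_reals all_analysis.
Import Order.TTheory GRing.Theory Num.Theory.
Local Open Scope ring_scope.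

(* Decides the equalities that hold in every abelian group: everything is moved
   to the left, and the head term is cancelled after rotating the other terms
   until its opposite comes next. *)
Ltac zmod :=
  apply/eqP; rewrite -subr_eq0; apply/eqP;
  rewrite ?(opprD, opprK, oppr0, addr0, add0r) -?addrA;
  repeat match goal with
  | |- ?x + - ?x = _ => exact: (subrr x)
  | |- - ?x + ?x = _ => exact: (addNr x)
  | |- ?x + (- ?x + ?y) = _ => rewrite (addNKr x y)
  | |- - ?x + (?x + ?y) = _ => rewrite (addKr x y)
  | |- _ + (?x + ?y) = _ => rewrite (addrC x y) -?addrA
  end.

Section DeformedBracket.
Context {V : zmodType} (B : V -> V -> V).
Implicit Types X Y : V.

Definition deformed (a : V -> V) (b : V -> V -> V) X Y :=
  b (a X) Y + b X (a Y) - a (b X Y).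

Definition nijenhuis (a : V -> V) (b : V -> V -> V) X Y :=
  b (a X) (a Y) - a (deformed a b X Y).

Context (i j : V -> V).
Hypothesis iD : {morph i : X Y / X + Y}.
Hypothesis iN : {morph i : X / - X}.
Hypothesis jD : {morph j : X Y / X + Y}.
Hypothesis jN : {morph j : X / - X}.
Hypothesis BNl : forall X Y, B (- X) Y = - B X Y.
Hypothesis BNr : forall X Y, B X (- Y) = - B X Y.
Hypothesis anti_ij : forall X, i (j X) = - j (i X).

Definition mixed_defect X Y :=
  B (j X) (i Y) + B (i X) (j Y) -
  (i (B (j X) Y + B X (j Y)) + j (B (i X) Y + B X (i Y))).

(** By anticommutation the terms of the two double deformations that contain both [i j] and [j i] in
    one place cancel; every other term occurs once in each of them, hence the factor 2. *)
Lemma concomitantE X Y :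
  deformed j (deformed i B) X Y + deformed i (deformed j B) X Y =
  mixed_defect X Y *+ 2.
Proof.
rewrite /deformed /mixed_defect mulr2n.
rewrite !(iD, iN, jD, jN, anti_ij, BNl, BNr).
by zmod.
Qed.

Lemma nijenhuis_deformed X Y : mixed_defect X Y = 0 ->
  nijenhuis j (deformed i B) X Y =
  - (nijenhuis j B (i X) Y + nijenhuis j B X (i Y) + i (nijenhuis j B X Y)).
Proof.
move=> H0; have H : j (mixed_defect X Y) = 0.
  by rewrite H0 -[X in j X](subrr 0) jD jN subrr.
(* The two sides differ by exactly [- j (mixed_defect X Y) *+ 2], so two vanishing copies are added
   before expanding. *)
rewrite -[LHS]addr0 -[X in _ + X]H -[LHS]addr0 -[X in _ + X]H.
rewrite /nijenhuis /deformed /mixed_defect.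
rewrite !(iD, iN, jD, jN, anti_ij, BNl, BNr).
by zmod.
Qed.

End DeformedBracket.

Section ScalarSquare.
Context {K : numFieldType} {V : lmodType K} (B : V -> V -> V).
Context (i j : {linear V -> V}) (lambda : K).
Implicit Types X Y : V.
Hypothesis BZl : forall a X Y, B (a *: X) Y = a *: B X Y.
Hypothesis BZr : forall a X Y, B X (a *: Y) = a *: B X Y.
Hypothesis anti_ij : forall X, i (j X) = - j (i X).
Hypothesis concomitant0 : forall X Y,
  deformed j (deformed i B) X Y + deformed i (deformed j B) X Y = 0.

Lemma nijenhuis_deformed_concomitant0 X Y :
  nijenhuis j (deformed i B) X Y =
  - (nijenhuis j B (i X) Y + nijenhuis j B X (i Y) + i (nijenhuis j B X Y)).
Proof.
have BNl X' Y' : B (- X') Y' = - B X' Y' by rewrite -scaleN1r BZl scaleN1r.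
have BNr X' Y' : B X' (- Y') = - B X' Y' by rewrite -scaleN1r BZr scaleN1r.
apply: nijenhuis_deformed => //; try by [exact: raddfD | exact: raddfN].
have /eqP := concomitant0 X Y.
rewrite concomitantE //; try by [exact: raddfD | exact: raddfN].
by rewrite -(scaler_nat 2 (mixed_defect B i j X Y)) scaler_eq0 pnatr_eq0 => /eqP.
Qed.

(** Lets [lambda] leave the torsion once [i (i X)] becomes [lambda *: X]. *)
Lemma nijenhuisZl a X Y : nijenhuis j B (a *: X) Y = a *: nijenhuis j B X Y.
Proof.
rewrite /nijenhuis /deformed !(linearZ, BZl) /=.
by rewrite -!scalerDr linearZ /= -scalerBr.
Qed.

Lemma nijenhuisZr a X Y : nijenhuis j B X (a *: Y) = a *: nijenhuis j B X Y.
Proof.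
rewrite /nijenhuis /deformed !(linearZ, BZr) /=.
by rewrite -!scalerDr linearZ /= -scalerBr.
Qed.

Hypothesis lambda_neq0 : lambda != 0.
Hypothesis i2 : forall X, i (i X) = lambda *: X.

Lemma nijenhuis_deformed_iff :
  (forall X Y, nijenhuis j B X Y = 0) <->
  (forall X Y, nijenhuis j (deformed i B) X Y = 0).
Proof.
split=> [T0 X Y|TI0].
  by rewrite nijenhuis_deformed_concomitant0 !T0 raddf0 !addr0 oppr0.
pose T := nijenhuis j B.
have TI X Y : T (i X) Y + T X (i Y) = - i (T X Y).
  apply/eqP; rewrite -subr_eq0 opprK -oppr_eq0.
  by rewrite -nijenhuis_deformed_concomitant0 TI0.
have Tii X Y : T (i X) (i Y) *+ 2 = - lambda *: T X Y.
  have := TI (i X) Y; have := TI X (i Y).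
  rewrite !i2 /T nijenhuisZl nijenhuisZr -/T => H1 H2.
  (* The sum of [H1] and [H2]: by [TI] once more, its right-hand side is [i (i (T X Y))]. *)
  have H3 : (T (i X) (i Y) + lambda *: T X Y) *+ 2 = lambda *: T X Y.
    rewrite mulr2n {1}H1 addrC [T (i X) _ + _]addrC H2.
    by rewrite -opprD -linearD TI linearN opprK i2.
  move: H3; rewrite mulrnDl [_ *: _ *+ 2]mulr2n addrA => /(canRL (addrK _)).
  by rewrite subrr scaleNr => /eqP; rewrite addr_eq0 => /eqP.
move=> X Y; apply/eqP.
have := Tii (i X) (i Y) => /(congr1 (fun Z => Z *+ 2)).
rewrite scalerMnr (Tii X Y) !i2 /T nijenhuisZl nijenhuisZr -/T -!mulrnA.
rewrite -(scaler_nat 4) !scalerA => /eqP; rewrite -subr_eq0 -scalerBl.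
rewrite scaler_eq0 => /orP[|//].
(* The coefficient of [T X Y] is [(4 - 1) * (lambda * lambda)], nonzero in characteristic zero. *)
rewrite mulrNN -mulrA -[X in _ - X]mul1r -mulrBl !mulf_eq0 (negPf lambda_neq0) !orbF.
by rewrite subr_eq0 (eqr_nat _ 4 1).
Qed.

End ScalarSquare.

Lemma on_section_linear {R : realType} {n r s : nat} {M : smoothManifold R n}
    {E : vectorBundle M r} {F : vectorBundle M s} (f : bundleMorphism E F) :
  linear (on_section f).
Proof. by move=> a X Y; apply: smoothSectionP => x; exact: linearP. Qed.

Theorem proposition3p3 (R : realType) (n r : nat) (M : smoothManifold R n)
    (E : vectorBundle M r) (g : bundleMetric E) (Theta : anchoredBracket E)
    (hTheta : pre_courant g Theta)
    (I J : bundleMorphism E E) (lambda : R)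
    (hIJ : forall (x : M) (e : E x), I x (J x e) = - J x (I x e))
    (hC : forall X Y : smoothSection E, concomitant Theta I J X Y = 0)
    (hlambda : lambda != 0)
    (hI2 : forall (x : M) (e : E x), I x (I x e) = lambda *: e) :
  (forall X Y : smoothSection E, torsion Theta J X Y = 0) <->
  (forall X Y : smoothSection E, torsion (deform I Theta) J X Y = 0).
Proof.
pose V := smoothSection E.
pose i := HB.pack_for {linear V -> V} (on_section I)
  (GRing.isLinear.Build _ _ _ _ _ (on_section_linear I)).
pose j := HB.pack_for {linear V -> V} (on_section J)
  (GRing.isLinear.Build _ _ _ _ _ (on_section_linear J)).
(* On the real vector space of sections, [torsion] and [concomitant] are convertible to the
   expressions in [nijenhuis] and [deformed]. *)
apply: (@nijenhuis_deformed_iff _ V (bracket Theta) i j lambda) => //.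
- by move=> a X Y; exact: (scalable_linear (bracket_linearl hTheta Y)).
- by move=> a X Y; exact: (scalable_linear (bracket_linearr hTheta X)).
- by move=> X; apply: smoothSectionP => x; exact: hIJ.
- by move=> X; apply: smoothSectionP => x; exact: hI2.
Qed.
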